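(* Let $\mathcal{A}$ be a minimal WFA with $n$ states over $\Sigma$, with transition matrices $A_a$, $a\in\Sigma$, such that $f_{\mathcal{A}}\neq 0$. Then $\mathcal{A}$ is uniformly convergent if and only if there exists a basis of $\mathbb{R}^n$ in which all the transition matrices $A_a$ have the form $$A_a=\begin{pmatrix} B_a & \mathbf{b}_a\\ \mathbf{0} & 1\end{pmatrix},$$ where $B_a$ is an $(n-1)\times(n-1)$ matrix, $\mathbf{b}_a$ is a column vector, $\mathbf{0}$ is a zero row vector, and $\{B_a : a\in\Sigma\}$ is a stable set.
   Context: $\Sigma$ is a nonempty finite alphabet; $\Sigma^*$ is the set of finite words, $\Sigma^\omega$ the set of infinite words; $\mathrm{pref}_k(w)$ is the prefix of $w$ of length $k$. A WFA $\mathcal{A}$ over $\Sigma$ with $n\ge 0$ states consists of an initial distribution $I\in\mathbb{R}^{1\times n}$, a final distribution $F\in\mathbb{R}^{n\times 1}$, and transition (weight) matrices $A_a\in\mathbb{R}^{n\times n}$, $a\in\Sigma$. For $v=v_1\cdots v_k\in\Sigma^*$ put $A_v=A_{v_1}\cdots A_{v_k}$ (the identity if $v$ is empty). The word function is $F_{\mathcal{A}}(v)=IA_vF$, and the $\omega$-function is $f_{\mathcal{A}}(w)=\lim_{k\to\infty}F_{\mathcal{A}}(\mathrm{pref}_k(w))$, undefined where the limit does not exist. $f_{\mathcal{A}}\ne0$ means that $f_{\mathcal{A}}$ is not the everywhere defined zero function. $\mathcal{A}$ is minimal if $\dim\langle IA_u: u\in\Sigma^*\rangle=n$ and $\dim\langle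 A_uF: u\in\Sigma^*\rangle=n$. $\mathcal{A}$ is uniformly convergent if for every $\epsilon>0$ there is $k_0$ such that $|F_{\mathcal{A}}(\mathrm{pref}_k(w))-f_{\mathcal{A}}(w)|<\epsilon$ for all $w\in\Sigma^\omega$ and $k>k_0$ (in particular $f_{\mathcal{A}}$ is everywhere defined). Changing the basis means replacing $I,F,A_a$ by $IM,\ M^{-1}F,\ M^{-1}A_aM$ for an invertible $n\times n$ matrix $M$. A finite nonempty family $\{B_a: a\in\Sigma\}$ of square matrices of the same size is stable if $\lim_{k\to\infty}B_{\mathrm{pref}_k(w)}=0$ for every $w\in\Sigma^\omega$, where $B_v=B_{v_1}\cdots B_{v_k}$. *)

(* Defs.v *)
From HB Require Import structures.
From mathcomp Require Import all_boot all_order all_algebra.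
From mathcomp Require Import all_classical all_reals all_analysis.
Set Implicit Arguments.
Unset Strict Implicit.
Unset Printing Implicit Defensive.
Import Order.TTheory GRing.Theory Num.Theory.
Import numFieldNormedType.Exports.
Local Open Scope classical_set_scope.
Local Open Scope ring_scope.

(* [span_set S] is the linear span of a possibly infinite set [S] of vectors of
   a finite-dimensional space, i.e. the set of all linear combinations of
   finitely many elements of [S]; existence is [span_setP]. *)
Definition is_span (K : fieldType) (vT : vectType K) (S : set vT)
    (U : {vspace vT}) : Prop :=
  forall v, v \in U <->
    exists2 X : seq vT, (forall x, x \in X -> S x) & v \in <<X>>%VS.

Definition span_set (K : fieldType) (vT : vectType K) (S : set vT) :
  {vspace vT} := xget 0%VS [set U | is_span S U].

Lemma span_setP (K : fieldType) (vT : vectType K) (S : set vT) :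
  is_span S (span_set S).
Proof.
suff [U HU] : exists U, is_span S U by exact: (xgetI 0%VS HU).
pose P d := `[< exists2 X : seq vT,
  (forall x, x \in X -> S x) & \dim <<X>>%VS = d >].
have exP : exists d, P d by exists (\dim <<[::] : seq vT>>%VS); apply/asboolP; exists [::].
have ubP d : P d -> (d <= \dim (fullv : {vspace vT}))%N.
  by move=> /asboolP[X _ <-]; exact/dimvS/subvf.
case: (ex_maxnP exP ubP) => d /asboolP[X SX dX] dmax.
exists <<X>>%VS => v; split => [vX|[Y SY vY]]; first by exists X.
have sub : (<<X>> <= <<X ++ Y>>)%VS by apply: sub_span => x xX; rewrite mem_cat xX.
have : (<<X>> == <<X ++ Y>>)%VS.
  rewrite eqEdim sub /= dX; apply: dmax; apply/asboolP; exists (X ++ Y) => //.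
  by move=> x; rewrite mem_cat => /orP[/SX|/SY].
move=> /eqP ->; apply: subvP vY; apply: sub_span => x xY.
by rewrite mem_cat xY orbT.
Qed.

Record wfa (R : realType) (Sigma : finType) (n : nat) := WFA {
  init : 'rV[R]_n;
  final : 'cV[R]_n;
  trans : Sigma -> 'M[R]_n }.

Definition word_mx (R : realType) (Sigma : finType) (n : nat)
    (M : Sigma -> 'M[R]_n) (v : seq Sigma) : 'M[R]_n :=
  \prod_(a <- v) M a.

Definition word_fun (R : realType) (Sigma : finType) (n : nat)
    (A : wfa R Sigma n) (v : seq Sigma) : R :=
  (init A *m word_mx (trans A) v *m final A) ord0 ord0.

Definition pref (Sigma : finType) (k : nat) (w : nat -> Sigma) : seq Sigma :=
  mkseq w k.

(* A partial function on infinite words: [None] means undefined. *)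
Definition omega_fun (R : realType) (Sigma : finType) (n : nat)
    (A : wfa R Sigma n) (w : nat -> Sigma) : option R :=
  let u : R^nat := fun k => word_fun A (pref k w) in
  if `[< cvgn u >] then Some (limn u) else None.

Definition minimal (R : realType) (Sigma : finType) (n : nat)
    (A : wfa R Sigma n) : Prop :=
  \dim (span_set (range (fun u => init A *m word_mx (trans A) u))) = n /\
  \dim (span_set (range (fun u => word_mx (trans A) u *m final A))) = n.

Definition uniformly_convergent (R : realType) (Sigma : finType) (n : nat)
    (A : wfa R Sigma n) : Prop :=
  exists2 f : (nat -> Sigma) -> R, (forall w, omega_fun A w = Some (f w)) &
    forall eps : R, 0 < eps -> exists k0 : nat,
      forall (w : nat -> Sigma) (k : nat), (k0 < k)%N ->
        `|word_fun A (pref k w) - f w| < eps.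

Definition change_basis (R : realType) (Sigma : finType) (n : nat)
    (A : wfa R Sigma n) (M : 'M[R]_n) : wfa R Sigma n :=
  WFA (init A *m M) (invmx M *m final A)
      (fun a => invmx M *m trans A a *m M).

Definition stable (R : realType) (Sigma : finType) (m : nat)
    (B : Sigma -> 'M[R]_m) : Prop :=
  forall w : nat -> Sigma, word_mx B (pref k w) @[k --> \oo] --> (0 : 'M[R]_m).

(* Main.v *)
Require Import Defs.
From HB Require Import structures.
From mathcomp Require Import all_boot all_order all_algebra.
From mathcomp Require Import all_classical all_reals all_analysis.
From mathcomp Require Import perm lra.
Set Implicit Arguments.
Unset Strict Implicit.
Unset Printing Implicit Defensive.
Import Order.TTheory GRing.Theory Num.Theory.
Import numFieldNormedType.Exports.
Local Open Scope classical_set_scope.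
Local Open Scope ring_scope.

(* Uniform convergence amounts to the Cauchy condition
   F_A(uv) - F_A(u) -> 0 as |u| -> oo, uniformly in u and v.

   Forward: choose w with f_A(w) != 0. The rows I A_{pref_k w} converge to a row
   l with l A_v F = f_A(w) for every v, so l A_a and l agree on the vectors
   A_v F, which span: l is fixed by every A_a. A basis change in which l is the
   last coordinate form gives the block shape. By the Cauchy condition,
   I A_u A_{pref_k w} (A_v F - F) -> 0, and the vectors A_v F - F span the kernel
   of l, on which the A_a act as the B_a; hence the family of the B_a is stable.

   Backward: by Koenig's lemma, stability yields N such that every word of
   length at least N has a nonempty prefix u of length at most N with
   |B_u| <= 1/2. Hence |B_u| -> 0 uniformly, while the upper right blocks of the
   A_v stay bounded, and F_A(uv) - F_A(u) is B_u times something bounded. *)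

(** * Entrywise limits of matrices and induction over a spanning set *)

Lemma cvg_mxP (R : realType) (T : Type) (F : set_system T) (FF : Filter F)
    (m n : nat) (G : T -> 'M[R]_(m, n)) (L : 'M[R]_(m, n)) :
  G k @[k --> F] --> L <->
  forall i j, G k i j @[k --> F] --> L i j.
Proof.
split=> [GL i j|GL]; first exact: cvg_comp GL (coord_continuous (x := L)).
move=> X [P PL sPX]; apply: filterS sPX _; apply: filter_forall => i.
by apply: filter_forall => j; exact: (GL i j).
Qed.

Lemma cvg_mulmx (R : realType) (T : Type) (F : set_system T) (FF : Filter F)
    (m n p : nat) (G : T -> 'M[R]_(m, n)) (H : T -> 'M[R]_(n, p))
    (L : 'M[R]_(m, n)) (M : 'M[R]_(n, p)) :
  G k @[k --> F] --> L -> H k @[k --> F] --> M ->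
  G k *m H k @[k --> F] --> L *m M.
Proof.
move=> /cvg_mxP GL /cvg_mxP HM; apply/cvg_mxP => i j.
rewrite mxE; under eq_fun do rewrite mxE.
apply: cvg_big => [|k _]; first by move=> x; exact: add_continuous.
by apply: cvgM; [exact: GL|exact: HM].
Qed.

(** Every vector is a combination of finitely many elements of [S], so a property stable under
    linear combinations need only be checked on [S]. Minimality is used in this form. *)
Lemma span_set_full_ind (K : fieldType) (vT : vectType K) (S : set vT)
    (P : vT -> Prop) :
  \dim (span_set S) = dim vT -> P 0 ->
  (forall a x y, P x -> P y -> P (a *: x + y)) -> (forall x, S x -> P x) ->
  forall x, P x.
Proof.
move=> dimS P0 Pl PS x.
have Sf : span_set S = fullv.
  by apply/eqP; rewrite eqEdim subvf dimvf dimS leqnn.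
have : x \in span_set S by rewrite Sf memvf.
move=> /(span_setP S)[X SX]; elim: X x SX => [|y X IH] x SX.
  by rewrite span_nil memv0 => /eqP->.
rewrite span_cons => /memv_addP[u /vlineP[a ->]] [v vX ->].
apply: Pl; first by apply/PS/SX; rewrite mem_head.
by apply: IH vX => z zX; apply: SX; rewrite in_cons zX orbT.
Qed.

(** * Word products, their block form and the Cauchy condition *)

Section Words.
Variables (R : realType) (Sigma : finType).

Lemma word_mx_nil (n : nat) (M : Sigma -> 'M[R]_n) : word_mx M [::] = 1%:M.
Proof. by rewrite /word_mx big_nil. Qed.

Lemma word_mx_cons (n : nat) (M : Sigma -> 'M[R]_n) a v :
  word_mx M (a :: v) = M a *m word_mx M v.
Proof. by rewrite /word_mx big_cons. Qed.

Lemma word_mx_cat (n : nat) (M : Sigma -> 'M[R]_n) u v :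
  word_mx M (u ++ v) = word_mx M u *m word_mx M v.
Proof. by rewrite /word_mx big_cat. Qed.

Lemma word_mx_conj (n : nat) (M : Sigma -> 'M[R]_n) (P : 'M[R]_n) v :
  P \in unitmx ->
  word_mx (fun a => P *m M a *m invmx P) v = P *m word_mx M v *m invmx P.
Proof.
move=> uP; elim: v => [|a v IH]; first by rewrite !word_mx_nil mulmx1 mulmxV.
by rewrite !word_mx_cons IH !mulmxA mulmxKV.
Qed.

Lemma word_fun_change_basis (n : nat) (A : wfa R Sigma n) (M : 'M[R]_n) v :
  M \in unitmx -> word_fun (change_basis A M) v = word_fun A v.
Proof.
move=> uM; rewrite /word_fun /=.
have := @word_mx_conj n (trans A) (invmx M) v.
rewrite unitmx_inv invmxK => -> //.
by rewrite !mulmxA !mulmxK.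
Qed.

(* [affine_part B b v] is the upper right block of the product along [v] of the
   matrices [[B a, b a], [0, 1]]. *)
Fixpoint affine_part (m : nat) (B : Sigma -> 'M[R]_m) (b : Sigma -> 'cV[R]_m)
    (v : seq Sigma) : 'cV[R]_m :=
  if v is a :: v' then B a *m affine_part B b v' + b a else 0.

Lemma affine_part_cat (m : nat) (B : Sigma -> 'M[R]_m) b u v :
  affine_part B b (u ++ v) =
  word_mx B u *m affine_part B b v + affine_part B b u.
Proof.
elim: u => [|a u IH] /=; first by rewrite word_mx_nil mul1mx addr0.
by rewrite IH word_mx_cons mulmxDr mulmxA addrA.
Qed.

Lemma word_mx_block (m : nat) (B : Sigma -> 'M[R]_m) b v :
  word_mx (fun a => block_mx (B a) (b a) (0 : 'rV[R]_m) (1%:M : 'M[R]_1)) v =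
  block_mx (word_mx B v) (affine_part B b v) 0 1%:M.
Proof.
elim: v => [|a v IH]; first by rewrite !word_mx_nil scalar_mx_block.
rewrite !word_mx_cons IH mulmx_block /=.
by rewrite !mulmx0 !mulmx1 !mul0mx !addr0 !add0r.
Qed.

Lemma pref_cat_nth (a : Sigma) (u : seq Sigma) k :
  (k <= size u)%N -> pref k (nth a u) = take k u.
Proof.
move=> ku; apply: (@eq_from_nth _ a).
  by rewrite size_mkseq size_takel.
move=> i; rewrite size_mkseq => ik.
by rewrite nth_mkseq // nth_take.
Qed.

Lemma omega_fun_Some (n : nat) (A : wfa R Sigma n) w (l : R) :
  omega_fun A w = Some l <-> word_fun A (pref k w) @[k --> \oo] --> l.
Proof.
rewrite /omega_fun; split=> [|cl].
  by case: asboolP => // cu [<-].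
case: asboolP => [cu|[]]; last by apply/cvg_ex; exists l.
by congr Some; exact/cvg_lim.
Qed.

(** Forward, [u ++ v] is extended to an infinite word, which takes a letter. Backward, completeness
    of the reals gives the limits, and the bound passes to the limit in the longer prefix. *)
Lemma uniformly_convergent_cauchy (n : nat) (A : wfa R Sigma n) :
  (0 < #|Sigma|)%N ->
  uniformly_convergent A <->
  forall eps : R, 0 < eps -> exists k0, forall u v, (k0 < size u)%N ->
    `|word_fun A (u ++ v) - word_fun A u| < eps.
Proof.
move=> /card_gt0P[a _]; split=> [[f _ fP] eps e0|cA].
  have e20 : 0 < eps / 2 by rewrite divr_gt0.
  have [k0 k0P] := fP _ e20; exists k0 => u v k0u.
  (* [w] is [u ++ v] followed by the letter [a] forever. *)
  pose w := nth a (u ++ v).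
  have := k0P w _ k0u; rewrite pref_cat_nth ?size_cat ?leq_addr //.
  rewrite take_size_cat // => h2.
  have /(k0P w) : (k0 < size (u ++ v))%N by rewrite size_cat ltn_addr.
  rewrite pref_cat_nth // take_size => h1.
  rewrite -(subrKA (f w)) (splitr eps) (le_lt_trans (ler_normD _ _)) //.
  by rewrite ltrD // distrC.
have cvgA w : exists l : R, word_fun A (pref k w) @[k --> \oo] --> l.
  apply/cvg_ex/cauchy_cvgP/cauchy_exP => eps e0.
  have [k0 k0P] := cA _ e0.
  exists (word_fun A (pref k0.+1 w)); exists k0.+1 => // k /= k0k.
  rewrite /ball /= distrC -(subnKC k0k) /pref /mkseq iotaD map_cat.
  by apply: k0P; rewrite size_map size_iota.
have [f fP] := choice cvgA.
exists f => [w|eps e0]; first exact/omega_fun_Some.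
have e20 : 0 < eps / 2 by rewrite divr_gt0.
(* Half of [eps], since a limit preserves only the non-strict inequality. *)
have [k0 k0P] := cA _ e20; exists k0 => w k k0k.
rewrite (@le_lt_trans _ _ (eps / 2)) // ?gtr_pMr // ?invf_lt1 ?ltr1n //.
have cd : `|word_fun A (pref k w) - word_fun A (pref l w)| @[l --> \oo] -->
    `|word_fun A (pref k w) - f w|.
  by apply: cvg_norm; apply: cvgB; [exact: cvg_cst|exact: fP].
apply: (cvgr_to_le cd); near=> l.
have kl : (k <= l)%N by near: l; exact: nbhs_infty_ge.
rewrite distrC /= -(subnKC kl) /pref /mkseq iotaD map_cat ltW //.
by apply: k0P; rewrite size_map size_iota.
Unshelve. all: by end_near.
Qed.

End Words.

(** * Koenig's lemma for bars of finite words *)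

(** An unsecured word has an unsecured one-letter extension; iterating from the empty word would
    give an infinite word with no prefix in [P]. *)
Lemma fan_theorem (Sigma : finType) (P : seq Sigma -> Prop) :
  (0 < #|Sigma|)%N -> (forall w, exists k, P (pref k w)) ->
  exists N, forall v, (N <= size v)%N ->
    exists2 k, (k <= N)%N & P (take k v).
Proof.
move=> /card_gt0P[a0 _] barP.
pose secured u := exists N, forall v, (N <= size v)%N ->
  exists2 k, (k <= size u + N)%N & P (take k (u ++ v)).
suff [N NP] : secured [::] by exists N => v /NP[k]; exists k.
apply: contrapT => nsec.
(* The implication stands under the existential so that choice yields a total function [next]. *)
have step u : exists a, ~ secured u -> ~ secured (rcons u a).
  apply: contrapT => /forallNP nstep.
  have /choice[N NP] a : exists N, forall v, (N <= size v)%N ->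
      exists2 k, (k <= size (rcons u a) + N)%N & P (take k (rcons u a ++ v)).
    by have /not_implyP[_ /contrapT] := nstep a.
  have /not_implyP[nsu _] := nstep a0; apply: nsu.
  (* One letter plus the largest bound among the finitely many extensions. *)
  exists (\max_a N a).+1 => -[//|a v] /=; rewrite ltnS => sv.
  have [|k kP Pk] := NP a v.
    by rewrite (leq_trans _ sv) // leq_bigmax.
  exists k; last by rewrite -cat_rcons.
  rewrite (leq_trans kP) // size_rcons addSnnS leq_add2l ltnS.
  exact: leq_bigmax.
have [next nextP] := choice step.
pose path k := iter k (fun u => rcons u (next u)) [::].
have npath k : ~ secured (path k) by elim: k => //= k; exact: nextP.
have pathE k : pref k (fun i => next (path i)) = path k.
  by elim: k => // k IH; rewrite /pref mkseqS -/(pref _ _) IH.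
have [k] := barP (fun i => next (path i)); rewrite pathE => Pk.
apply: (npath k); exists 0%N => v _; exists (size (path k)).
  by rewrite addn0.
by rewrite take_size_cat.
Qed.

(** * A submultiplicative matrix norm *)

Section L1Norm.
Variable R : realType.

(* The entrywise norm, unlike the max norm of the library, is
   submultiplicative. *)
Definition l1norm (m n : nat) (A : 'M[R]_(m, n)) : R :=
  \sum_i \sum_j `|A i j|.

Lemma l1norm_ge0 (m n : nat) (A : 'M[R]_(m, n)) : 0 <= l1norm A.
Proof. by do 2!apply: sumr_ge0 => ? _. Qed.

Lemma l1norm_ge (m n : nat) (A : 'M[R]_(m, n)) i j : `|A i j| <= l1norm A.
Proof.
rewrite /l1norm (bigD1 i) //= (bigD1 j) //= -addrA lerDl addr_ge0 //.
  by apply: sumr_ge0.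
by do 2!apply: sumr_ge0 => ? _.
Qed.

Lemma l1normD (m n : nat) (A B : 'M[R]_(m, n)) :
  l1norm (A + B) <= l1norm A + l1norm B.
Proof.
rewrite -big_split ler_sum // => i _.
by rewrite -big_split ler_sum // => j _; rewrite mxE ler_normD.
Qed.

Lemma l1normM (m n p : nat) (A : 'M[R]_(m, n)) (B : 'M[R]_(n, p)) :
  l1norm (A *m B) <= l1norm A * l1norm B.
Proof.
rewrite /l1norm mulr_suml ler_sum // => i _.
apply: (@le_trans _ _ (\sum_j \sum_k `|A i k| * `|B k j|)).
  apply: ler_sum => j _; rewrite mxE (le_trans (ler_norm_sum _ _ _)) //.
  by apply: ler_sum => k _; rewrite normrM.
rewrite exchange_big mulr_suml ler_sum // => k _.
rewrite -mulr_sumr ler_wpM2l //.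
rewrite [leRHS](bigD1 k) //= lerDl.
by do 2!apply: sumr_ge0 => ? _.
Qed.

Lemma cvg_l1norm0 (T : Type) (F : set_system T) (FF : Filter F)
    (m n : nat) (G : T -> 'M[R]_(m, n)) :
  G k @[k --> F] --> (0 : 'M[R]_(m, n)) -> l1norm (G k) @[k --> F] --> (0 : R).
Proof.
move=> /cvg_mxP G0.
have -> : 0 = l1norm (0 : 'M[R]_(m, n)).
  by rewrite /l1norm !big1 // => i _; rewrite big1 // => j _;
    rewrite mxE normr0.
apply: cvg_big => [x|i _]; first exact: add_continuous.
apply: cvg_big => [x|j _]; first exact: add_continuous.
by apply: cvg_norm; exact: G0.
Qed.

End L1Norm.

(** * Boundedness and uniform decay for stable families *)

Section StableFamilies.
Variables (R : realType) (Sigma : finType).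

Lemma bounded_short_words (g : seq Sigma -> R) (N : nat) :
  exists K, forall v, (size v <= N)%N -> g v <= K.
Proof.
elim: N g => [|N IH] g.
  by exists (g [::]) => v; rewrite leqn0 size_eq0 => /eqP->.
have /choice[K KP] a := IH (fun v => g (a :: v)).
exists (`|g [::]| + \sum_a `|K a|) => -[_|a v /=].
  by rewrite (le_trans (ler_norm _)) // lerDl sumr_ge0.
move=> /KP /le_trans; apply; rewrite (le_trans (ler_norm _)) //.
by rewrite (bigD1 a) //= addrCA lerDl addr_ge0 // sumr_ge0.
Qed.

Lemma contracting_words_bounded (g : seq Sigma -> R) (N : nat) (C : R) :
  (forall v, (N <= size v)%N -> exists u v',
     [/\ v = u ++ v', (0 < size u)%N & g v <= 2^-1 * g v' + C]) ->
  exists2 K, 0 <= K & forall v, g v <= K.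
Proof.
move=> contr; have [K0 K0P] := bounded_short_words g N.
(* [|K0|] covers the short words; the term [2 * |C|] makes the bound survive the map from x to x/2 +
   C. *)
pose K := `|K0| + 2 * `|C|; exists K; first by rewrite addr_ge0.
move=> v; have [n] := ubnP (size v); elim: n v => // n IH v.
rewrite ltnS => vn; have [vN|Nv] := leqP (size v) N.
  by rewrite (le_trans (K0P _ vN)) // (le_trans (ler_norm _)) // lerDl.
have [u [v' [ve u0 gv]]] := contr _ (ltnW Nv).
have /IH gv' : (size v' < n)%N.
  by rewrite (leq_trans _ vn) // ve size_cat -[ltnLHS]add0n ltn_add2r.
have := ler_norm C; rewrite /K in gv' *; have := normr_ge0 K0; lra.
Qed.

Variables (m : nat) (B : Sigma -> 'M[R]_m).
Hypotheses (Sigma_gt0 : (0 < #|Sigma|)%N) (stB : stable B).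

Lemma stable_short_contraction : exists N, forall v, (N <= size v)%N ->
  exists u v', [/\ v = u ++ v', (0 < size u <= N)%N &
                   l1norm (word_mx B u) <= 2^-1].
Proof.
(* Nonemptiness makes the remaining word strictly shorter, as induction on length requires. *)
pose P u := (0 < size u)%N /\ l1norm (word_mx B u) <= 2^-1.
have [w|N NP] := @fan_theorem _ P Sigma_gt0.
  have [k _ kP] : \forall k \near \oo, l1norm (word_mx B (pref k w)) <= 2^-1.
    by apply: cvgr_le (cvg_l1norm0 _ (stB w)) _ _; rewrite invr_gt0.
  (* The successor, because [k] itself may be 0. *)
  exists k.+1; split; first by rewrite size_mkseq.
  exact: kP (leqnSn k).
exists N => v /NP[k kN [tk0 tkP]].
exists (take k v), (drop k v); rewrite cat_take_drop tk0 /=; split=> //.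
by rewrite size_take_min (leq_trans (geq_minl _ _)).
Qed.

Lemma stable_bounded : exists2 K, 0 <= K & forall v, l1norm (word_mx B v) <= K.
Proof.
have [N NP] := stable_short_contraction.
apply: (@contracting_words_bounded _ N 0) => v /NP[u [v' [ve /andP[u0 _] Bu]]].
exists u, v'; split => //; rewrite addr0 ve word_mx_cat.
by rewrite (le_trans (l1normM _ _)) // ler_wpM2r // l1norm_ge0.
Qed.

(** Splitting off a contracting prefix [u] halves the contribution of the rest and adds the affine
    part of [u], which is bounded because [u] has length at most [N]. *)
Lemma stable_affine_bounded (b : Sigma -> 'cV[R]_m) :
  exists2 K, 0 <= K & forall v, l1norm (affine_part B b v) <= K.
Proof.
have [N NP] := stable_short_contraction.
have [C CP] := bounded_short_words (fun v => l1norm (affine_part B b v)) N.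
apply: (@contracting_words_bounded _ N C) => v.
move=> /NP[u [v' [ve /andP[u0 uN] Bu]]].
exists u, v'; split => //; rewrite ve affine_part_cat.
rewrite (le_trans (l1normD _ _)) // lerD ?CP //.
by rewrite (le_trans (l1normM _ _)) // ler_wpM2r // l1norm_ge0.
Qed.

Lemma stable_uniform (eps : R) : 0 < eps ->
  exists N, forall v, (N <= size v)%N -> l1norm (word_mx B v) < eps.
Proof.
move=> e0; have [N NP] := stable_short_contraction.
have [K K0 KP] := stable_bounded.
(* Such a word splits off [r] contracting prefixes of length at most [N]; what remains is bounded by
   [K]. *)
have pow r v : (r * N <= size v)%N -> l1norm (word_mx B v) <= 2^-1 ^+ r * K.
  elim: r v => [v _|r IH v]; first by rewrite expr0 mul1r.
  rewrite mulSn => rv.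
  have [u [v' [ve /andP[_ uN] Bu]]] := NP v (leq_trans (leq_addr _ _) rv).
  rewrite ve word_mx_cat (le_trans (l1normM _ _)) // exprS -mulrA.
  rewrite ler_pM ?l1norm_ge0 // IH //.
  rewrite -(leq_add2l N) (leq_trans rv) // ve size_cat leq_add2r //.
have : 2^-1 ^+ r * K @[r --> \oo] --> (0 : R).
  rewrite -(mul0r K); apply: cvgMl; apply: cvg_expr.
  by rewrite ger0_norm ?invr_ge0 ?ler0n // invf_lt1 ?ltr1n ?ltr0n.
move=> pow0; have [r _ rP] : \forall r \near \oo, 2^-1 ^+ r * K < eps.
  exact: cvgr_lt pow0 _ e0.
by exists (r * N)%N => v /pow/le_lt_trans; apply; apply: rP => /=.
Qed.

End StableFamilies.

(** * From the block form to uniform convergence *)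

Lemma stable_block_uniformly_convergent (R : realType) (Sigma : finType)
    (m : nat) (A : wfa R Sigma (m + 1)) (B : Sigma -> 'M[R]_m)
    (b : Sigma -> 'cV[R]_m) :
  (0 < #|Sigma|)%N -> stable B ->
  trans A = (fun a => block_mx (B a) (b a) (0 : 'rV[R]_m) (1%:M : 'M[R]_1)) ->
  uniformly_convergent A.
Proof.
move=> Sigma_gt0 stB trA; apply/uniformly_convergent_cauchy => // eps e0.
have [K K0 KP] := stable_bounded Sigma_gt0 stB.
have [L L0 LP] := stable_affine_bounded Sigma_gt0 stB b.
pose I1 := lsubmx (init A); pose F1 := usubmx (final A).
pose F2 := dsubmx (final A).
(* The last row of [A_v - 1] vanishes, so [B_u] is the only factor left that depends on [u]. *)
have diffE u v : word_fun A (u ++ v) - word_fun A u =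
    (I1 *m word_mx B u *m
      ((word_mx B v - 1%:M) *m F1 + affine_part B b v *m F2)) ord0 ord0.
  have -> : word_fun A (u ++ v) - word_fun A u =
      (init A *m word_mx (trans A) u *m
        ((word_mx (trans A) v - 1%:M) *m final A)) ord0 ord0.
    rewrite /word_fun word_mx_cat mulmxBl mul1mx mulmxBr !mulmxA.
    by rewrite [RHS]mxE [X in _ = _ + X]mxE.
  congr (_ ord0 ord0); rewrite trA !word_mx_block scalar_mx_block.
  rewrite -[init A]hsubmxK -[final A]vsubmxK.
  rewrite opp_block_mx add_block_mx mul_row_block mul_block_col mul_row_col.
  by rewrite !(subrr, subr0, mulmx0, mul0mx, addr0).
pose C := l1norm I1 * ((K + l1norm (- 1%:M : 'M[R]_m)) * l1norm F1
                       + L * l1norm F2).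
have C0 : 0 <= C.
  by rewrite mulr_ge0 ?l1norm_ge0 // addr_ge0 // mulr_ge0 ?addr_ge0 ?l1norm_ge0.
(* [C] bounds the factors other than [B_u], uniformly in [v]; it may be 0, hence [C + 1]. *)
have e'0 : 0 < eps / (C + 1) by rewrite divr_gt0 // ltr_wpDl.
have [N NP] := stable_uniform Sigma_gt0 stB e'0.
exists N => u v /ltnW/NP; rewrite ltr_pdivlMr ?ltr_wpDl // => Bu.
rewrite diffE (le_lt_trans (l1norm_ge _ _ _)) // (le_lt_trans _ Bu) //.
apply: (@le_trans _ _ (l1norm (word_mx B u) * C)); last first.
  by rewrite ler_wpM2l ?l1norm_ge0 // lerDl.
rewrite /C mulrCA mulrA.
rewrite (le_trans (l1normM _ _)) // ler_pM ?l1norm_ge0 ?l1normM //.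
rewrite (le_trans (l1normD _ _)) // lerD // (le_trans (l1normM _ _)) //.
  rewrite ler_wpM2r ?l1norm_ge0 // (le_trans (l1normD _ _)) // lerD2r //.
by rewrite ler_wpM2r ?l1norm_ge0.
Qed.

(** * From uniform convergence to the block form *)

(** The rank factorization makes [l] a nonzero multiple of the first row of the invertible
    [row_ebase l]; scaling and swapping that row into last place gives [P]. *)
Lemma unitmx_complete_last (K : fieldType) (m : nat) (l : 'rV[K]_(m + 1)) :
  l != 0 ->
  exists2 P : 'M[K]_(m + 1), P \in unitmx & dsubmx P = l.
Proof.
move=> l0; have rkl : \rank l = 1%N.
  by apply/eqP; rewrite eqn_leq rank_leq_row lt0n mxrank_eq0.
pose i0 : 'I_(m + 1) := cast_ord (addnC 1 m) ord0.
pose U := row_ebase l; pose d := col_ebase l ord0 ord0.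
have lE : l = d *: row i0 U.
  apply/rowP => j; rewrite -[in LHS](mulmx_ebase l) rkl !mxE (bigD1 i0) //=.
  rewrite mxE big_ord1 !mxE /= mulr1 big1 ?addr0 // => i ii0.
  rewrite mxE big_ord1 !mxE.
  rewrite (_ : _ && _ = false) ?mulr0 ?mul0r //.
  by apply: contra_neqF ii0 => /andP[/eqP i0E _]; apply/val_inj.
have d0 : d != 0.
  by apply: contra_neq l0 => d0; rewrite lE d0 scale0r.
exists (d *: row_perm (tperm i0 (rshift m ord0)) U).
  by rewrite unitmxZ ?unitfE // row_permE unitmx_mul unitmx_perm row_ebase_unit.
by apply/rowP => j; rewrite [in RHS]lE !mxE ord1 tpermR.
Qed.

Section UniformlyConvergent.
Variables (R : realType) (Sigma : finType) (n : nat) (A : wfa R Sigma n).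
Hypotheses (Sigma_gt0 : (0 < #|Sigma|)%N) (minA : minimal A).
Hypothesis ucA : uniformly_convergent A.

Local Notation W := (word_mx (trans A)).

Lemma left_words_ind (P : 'rV[R]_n -> Prop) : P 0 ->
  (forall a x y, P x -> P y -> P (a *: x + y)) ->
  (forall u, P (init A *m W u)) -> forall x, P x.
Proof.
move=> P0 Pl Pw; case: minA => dimL _.
apply: (@span_set_full_ind _ _ (range (fun u => init A *m W u))) P0 Pl _.
  by rewrite dimL dim_matrix; apply/esym/mul1n.
by move=> _ [u _ <-].
Qed.

Lemma right_words_ind (P : 'cV[R]_n -> Prop) : P 0 ->
  (forall a x y, P x -> P y -> P (a *: x + y)) ->
  (forall u, P (W u *m final A)) -> forall x, P x.
Proof.
move=> P0 Pl Pw; case: minA => _ dimR.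
apply: (@span_set_full_ind _ _ (range (fun u => W u *m final A))) P0 Pl _.
  by rewrite dimR dim_matrix; apply/esym/muln1.
by move=> _ [u _ <-].
Qed.

(** The contexts [u] and [v] will run over the spanning rows [I A_u] and columns [A_v F]. *)
Lemma cvg_word_fun_extend u v w :
  word_fun A (u ++ pref k w ++ v) - word_fun A (u ++ pref k w)
    @[k --> \oo] --> (0 : R).
Proof.
move: ucA => /uniformly_convergent_cauchy-/(_ Sigma_gt0) cA.
apply/cvgr0Pnorm_lt => eps e0; have [k0 k0P] := cA _ e0.
exists k0.+1 => // k /= k0k; rewrite catA; apply: k0P.
by rewrite size_cat size_mkseq ltn_addl.
Qed.

(* [l] is the limit of the rows [init A *m W (pref k w)] along a word [w] on
   which the omega-function does not vanish. *)
Lemma fixed_row : omega_fun A <> (fun=> Some 0) ->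
  exists l : 'rV[R]_n,
    (l *m final A) ord0 ord0 != 0 /\ forall a, l *m trans A a = l.
Proof.
move=> f0; have [f fP _] := ucA.
have [w fw0] : exists w, f w != 0.
  apply: contrapT => /forallNP nf; apply: f0; apply/funext => w.
  by rewrite fP; congr Some; apply/eqP; apply: contrapT => /negP; exact: nf.
have /omega_fun_Some cf := fP w.
have cA v : word_fun A (pref k w ++ v) @[k --> \oo] --> f w.
  exact: cvg_sub0 (cvg_word_fun_extend [::] v w) cf.
(* Convergence against the spanning columns [A_v F] gives it against every column, hence
   entrywise. *)
have cy (y : 'cV[R]_n) :
    cvgn (fun k => (init A *m W (pref k w) *m y) ord0 ord0).
  apply: (@right_words_ind (fun y =>
    cvgn (fun k => (init A *m W (pref k w) *m y) ord0 ord0))) y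
    => [|a x y cx cy|v].
  - under eq_fun do rewrite mulmx0 mxE; exact: is_cvg_cst.
  - under eq_fun do rewrite mulmxDr -scalemxAr mxE [X in X + _]mxE.
    by apply: is_cvgD => //; apply: is_cvgM => //; exact: is_cvg_cst.
  - apply/cvg_ex; exists (f w); apply: cvg_trans (cA v).
    apply: near_eq_cvg; near=> k.
    by rewrite /word_fun word_mx_cat !mulmxA.
have cr j : cvgn (fun k => (init A *m W (pref k w)) ord0 j).
  have := cy (delta_mx j ord0); under eq_fun do rewrite -colE mxE; exact.
have [l0 l0P] := choice (fun j => (cvg_ex _).1 (cr j)).
pose l := \row_j l0 j.
have cl : init A *m W (pref k w) @[k --> \oo] --> l.
  by apply/cvg_mxP => i j; rewrite ord1 mxE; exact: l0P.
have lW v : (l *m (W v *m final A)) ord0 ord0 = f w.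
  have /cvg_mxP/(_ ord0 ord0) h : init A *m W (pref k w) *m (W v *m final A)
      @[k --> \oo] --> l *m (W v *m final A).
    by apply: cvg_mulmx => //; exact: cvg_cst.
  apply: norm_cvg_unique h _; apply: cvg_trans (cA v).
  by apply: near_eq_cvg; near=> k; rewrite /word_fun word_mx_cat !mulmxA.
exists l; split; first by have := lW [::]; rewrite word_mx_nil mul1mx => ->.
(* [l A_a] and [l] both take the value [f w] on every [A_v F]. *)
move=> a; suff H (y : 'cV[R]_n) : l *m trans A a *m y = l *m y.
  by apply/rowP => j; have /matrixP/(_ ord0 ord0) := H (delta_mx j ord0);
     rewrite -!colE !mxE.
apply: (@right_words_ind (fun y => l *m trans A a *m y = l *m y)) y
  => [|b x y Hx Hy|v].
- by rewrite !mulmx0.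
- by rewrite !mulmxDr -!scalemxAr Hx Hy.
- apply/matrixP => i j; rewrite !ord1 lW -mulmxA [trans A a *m _]mulmxA.
  by rewrite -word_mx_cons lW.
Unshelve. all: by end_near.
Qed.

Lemma cvg_word_mx_ker (l : 'rV[R]_n) :
  (l *m final A) ord0 ord0 != 0 -> (forall a, l *m trans A a = l) ->
  forall w (y : 'cV[R]_n) (x : 'rV[R]_n), l *m y = 0 ->
    (x *m W (pref k w) *m y) ord0 ord0 @[k --> \oo] --> (0 : R).
Proof.
move=> lF la w y0 x0 ly0; set c := (l *m final A) ord0 ord0 in lF.
have lW v : l *m W v = l.
  elim: v => [|a v IH]; first by rewrite word_mx_nil mulmx1.
  by rewrite word_mx_cons mulmxA la.
(* [D] is [c] times the projection onto the kernel of [l] along [F]. It sends [A_v F] to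
   [c (A_v F - F)], where the Cauchy condition applies, and multiplies the kernel by [c]. *)
pose D (y : 'cV[R]_n) := c *: y - final A *m (l *m y).
have DP b y z : D (b *: y + z) = b *: D y + D z.
  rewrite /D !mulmxDr -!scalemxAr scalerDr scalerBr !scalerA [c * b]mulrC.
  by rewrite opprD addrACA.
have D0 : D 0 = 0 by rewrite /D !mulmx0 scaler0 subrr.
have DW v : D (W v *m final A) = c *: (W v *m final A - final A).
  by rewrite /D [l *m _]mulmxA lW scalerBr [l *m _]mx11_scalar mul_mx_scalar.
have cvgl (x : 'rV[R]_n) b y z :
    (x *m W (pref k w) *m y) ord0 ord0 @[k --> \oo] --> (0 : R) ->
    (x *m W (pref k w) *m z) ord0 ord0 @[k --> \oo] --> (0 : R) ->
    (x *m W (pref k w) *m (b *: y + z)) ord0 ord0 @[k --> \oo] --> (0 : R).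
  move=> cy cz; under eq_fun do rewrite mulmxDr -scalemxAr mxE [X in X + _]mxE.
  rewrite -[0]addr0 -{1}(mulr0 b); apply: cvgD => //.
  by apply: cvgM => //; exact: cvg_cst.
have cx u (y : 'cV[R]_n) :
    (init A *m W u *m W (pref k w) *m D y) ord0 ord0 @[k --> \oo] --> (0 : R).
  apply: (@right_words_ind (fun y =>
      (init A *m W u *m W (pref k w) *m D y) ord0 ord0
        @[k --> \oo] --> (0 : R))) y => [|b y z cy cz|v].
  - by rewrite D0; under eq_fun do rewrite mulmx0 mxE; exact: cvg_cst.
  - by rewrite DP; exact: cvgl.
  - rewrite DW -[_ *: _]addr0; apply: cvgl; last first.
      by under eq_fun do rewrite mulmx0 mxE; exact: cvg_cst.
    apply: cvg_trans (cvg_word_fun_extend u v w).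
    apply: near_eq_cvg; near=> k.
    rewrite /word_fun !word_mx_cat mulmxBr !mulmxA.
    by rewrite [in RHS]mxE [X in _ = _ + X]mxE.
have -> : y0 = c^-1 *: D y0.
  by rewrite /D ly0 mulmx0 subr0 scalerA mulVf // scale1r.
(* The rows [I A_u] span, so the limit extends from them to any row. *)
apply: (@left_words_ind (fun x =>
    (x *m W (pref k w) *m (c^-1 *: D y0)) ord0 ord0 @[k --> \oo] --> (0 : R)))
  x0 => [|b x z cy cz|v].
- by under eq_fun do rewrite !mul0mx mxE; exact: cvg_cst.
- under eq_fun do rewrite !mulmxDl -!scalemxAl mxE [X in X + _]mxE.
  rewrite -[0]addr0 -{1}(mulr0 b); apply: cvgD => //.
  by apply: cvgM => //; exact: cvg_cst.
- rewrite -[_ *: _]addr0; apply: cvgl => //.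
  by under eq_fun do rewrite mulmx0 mxE; exact: cvg_cst.
Unshelve. all: by end_near.
Qed.

End UniformlyConvergent.

(** If [P] has last row [l], invariance of [l] makes the last row of [P A_a P^-1] equal to [l P^-1],
    the last unit row. *)
Lemma uniformly_convergent_stable_block (R : realType) (Sigma : finType)
    (m : nat) (A : wfa R Sigma (m + 1)) (l : 'rV[R]_(m + 1)) :
  (0 < #|Sigma|)%N -> minimal A -> uniformly_convergent A ->
  (l *m final A) ord0 ord0 != 0 -> (forall a, l *m trans A a = l) ->
  exists (M : 'M[R]_(m + 1)) (B : Sigma -> 'M[R]_m) (b : Sigma -> 'cV[R]_m),
    [/\ M \in unitmx,
        forall a : Sigma, trans (change_basis A M) a =
          block_mx (B a) (b a) (0 : 'rV[R]_m) (1%:M : 'M[R]_1)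
      & stable B].
Proof.
move=> Sigma_gt0 minA ucA lF la.
have l0 : l != 0 by apply: contra_neq lF => ->; rewrite mul0mx mxE.
have [P uP Pl] := unitmx_complete_last l0.
have lP : l *m invmx P = row_mx 0 1%:M.
  by rewrite -Pl mul_dsub_mx mulmxV // scalar_mx_block block_mxEv col_mxKd.
pose T a := P *m trans A a *m invmx P.
have TE a : T a = block_mx (ulsubmx (T a)) (ursubmx (T a)) 0 1%:M.
  rewrite -[LHS]vsubmxK block_mxEv hsubmxK; congr col_mx.
  by rewrite /T -!mul_dsub_mx Pl la lP.
exists (invmx P), (fun a => ulsubmx (T a)), (fun a => ursubmx (T a)).
split=> [|a|w]; [by rewrite unitmx_inv|by rewrite /= invmxK; exact: TE|].
have BE v : word_mx (fun a => ulsubmx (T a)) v =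
    usubmx P *m word_mx (trans A) v *m lsubmx (invmx P).
  have := congr1 (fun M => ulsubmx (word_mx M v)) (funext TE) => /=.
  rewrite word_mx_block block_mxKul word_mx_conj // => <-.
  by rewrite /ulsubmx -!mul_usub_mx -mulmx_lsub.
apply/cvg_mxP => i j; rewrite mxE.
(* Each entry of [B_v] is a row of [P] times [A_v] times a column of [P^-1] other than the last, and
   [l] kills that column. *)
have ly : l *m col j (lsubmx (invmx P)) = 0.
  by rewrite colE mulmxA mulmx_lsub lP row_mxKl mul0mx.
have := cvg_word_mx_ker Sigma_gt0 minA ucA lF la w (row i (usubmx P)) ly.
apply: cvg_trans; apply: near_eq_cvg; near=> k.
by rewrite BE colE -!row_mul mulmxA -colE mxE [LHS]mxE.
Unshelve. all: by end_near.
Qed.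

(** * The equivalence in an arbitrary basis *)

Unset Implicit Arguments.

Theorem corollary37 (R : realType) (Sigma : finType) (n : nat)
    (A : wfa R Sigma n) (hSigma : (0 < #|Sigma|)%N)
    (hmin : minimal A) (hf : omega_fun A <> (fun=> Some 0)) :
  uniformly_convergent A <->
  exists (m : nat) (e : (m + 1)%N = n) (M : 'M[R]_n)
         (B : Sigma -> 'M[R]_m) (b : Sigma -> 'cV[R]_m),
    [/\ M \in unitmx,
        forall a : Sigma, trans (change_basis A M) a =
          castmx (e, e) (block_mx (B a) (b a) (0 : 'rV[R]_m) (1%:M : 'M[R]_1))
      & stable B].
Proof.
split=> [ucA|[m [e [M [B [b [uM AE stB]]]]]]]; last first.
  subst n; have ucM : uniformly_convergent (change_basis A M).
    apply: (stable_block_uniformly_convergent (B := B) (b := b)) => //.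
    by apply/funext => a; rewrite AE castmx_id.
  (* The Cauchy condition involves only the word function, which a change of basis preserves. *)
  apply/uniformly_convergent_cauchy => // eps e0.
  have [k0 k0P] := (uniformly_convergent_cauchy _ hSigma).1 ucM _ e0.
  by exists k0 => u v /(k0P _ v); rewrite !word_fun_change_basis.
have [l [lF la]] := fixed_row hSigma hmin ucA hf.
(* For [n = 0] the scalar [l F] would be an empty sum, contradicting [lF]. *)
have [m e] : exists m, (m + 1 = n)%N.
  case: n A {hmin hf ucA la} l lF => [A l|m *]; last by exists m; rewrite addn1.
  by rewrite mxE big_ord0 eqxx.
subst n; exists m, (erefl _).
have [M [B [b [uM AE stB]]]] :=
  uniformly_convergent_stable_block hSigma hmin ucA lF la.
by exists M, B, b; split=> // a; rewrite castmx_id.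
Qed.
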